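(* Let $m$ be a positive integer, let $\varepsilon$ be a real number with $\frac{m-2}{m}\le\varepsilon\le\frac{m-1}{m}$, and let $\delta>0$ be real. For every sufficiently large integer $n$ there exists a binary (i.e. over $\mathbb{F}_2$) $n^{\varepsilon-\delta}$-batch code of length $N$ and dimension $n$ such that the redundancy $N-n$ satisfies $$N-n=O\left(n^{(m-\log\lambda_m)\varepsilon+\left((m-1)\log\lambda_m/m-m+2\right)}\right),$$ where the asymptotics are as $n\to\infty$ with $m,\varepsilon,\delta$ fixed.
   Context: $\log$ is the logarithm in base two. $\mathbb{F}_q$ is the field with $q$ elements and $[n]=\{1,\dots,n\}$. Batch code. Let $F:\mathbb{F}_q^n\to\mathbb{F}_q^N$ be an encoding map (injective) sending $(x_1,\dots,x_n)$ to $(y_1,\dots,y_N)$ and let $\mathcal{C}$ be the image of $F$. The code $\mathcal{C}$ (with length $N$ and dimension $n$) is a $k$-batch code if for every multiset of message symbols $\{x_{i_1},\dots,x_{i_k}\}$, $i_j\in[n]$, there exist $k$ mutually disjoint sets $R_1,\dots,R_k\subset[N]$ and functions $g_1,\dots,g_k$ such that for all $\mathbf y=F(x_1,\dots,x_n)\in\mathcal{C}$ and all $j\in[k]$, $g_j(\mathbf y|_{R_j})=x_{i_j}$, where $\mathbf y|_R$ is the projection of $\mathbf y$ onto the coordinates in $R$. The code is binary if $q=2$. If $k>0$ is not an integer, ''$k$-batch'' means $\lceil k\rceil$-batch. The number $\lambda_m$. Let $A_m$ be the $m\times m$ matrix with rows and columns indexed by $0,1,\dots,m-1$ whose entry in row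 $j$ and column $0$ is $\binom{m}{\ge 2j+1}$ and whose entry in row $j$ and column $c\ge 1$ is $\binom{m}{2j+1-c}$. Here $\binom{b}{\ge a}$ is the number of subsets with at least $a$ elements of a $b$-element set, and $\binom{b}{a}=0$ if $a<0$ or $a>b$. Then $\lambda_m$ is the largest eigenvalue of $A_m$ ($A_m$ is entrywise non-negative, so this is its spectral radius). *)

(* Defs.v *)
From mathcomp Require Export all_boot all_order all_algebra.
From mathcomp Require Export all_classical all_reals all_analysis.
Export numFieldNormedType.Exports.

Set Implicit Arguments.
Unset Strict Implicit.
Unset Printing Implicit Defensive.

Import Order.TTheory GRing.Theory Num.Theory.
Local Open Scope ring_scope.

Definition restrict_to (F : finFieldType) (N : nat) (A : {set 'I_N})
    (y : 'rV[F]_N) : {ffun {l : 'I_N | l \in A} -> F} :=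
  [ffun l => y 0 (val l)].

(* The batch property is stated for the encoding map, since it refers to the
   message symbols and not only to the image of the map.  A multiset of k
   message symbols is presented as a k-tuple i of indices, repetitions
   allowed. *)
Definition batch_code (F : finFieldType) (n N k : nat)
    (enc : 'rV[F]_n -> 'rV[F]_N) : Prop :=
  injective enc /\
  forall i : k.-tuple 'I_n,
    exists (A : 'I_k -> {set 'I_N})
           (g : forall j : 'I_k, {ffun {l : 'I_N | l \in A j} -> F} -> F),
      (forall j j' : 'I_k, j != j' -> [disjoint A j & A j']) /\
      (forall (x : 'rV[F]_n) (j : 'I_k),
         g j (restrict_to (A j) (enc x)) = x 0 (tnth i j)).

(* Intended for k > 0, where the ceiling is positive and the absolute value
   only converts it from int to nat. *)
Definition real_batch_code (R : realType) (F : finFieldType) (n N : nat)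
    (k : R) (enc : 'rV[F]_n -> 'rV[F]_N) : Prop :=
  batch_code `|Num.ceil k|%N enc.

Definition binom_ge (b a : nat) : nat :=
  #|[set S : {set 'I_b} | (a <= #|S|)%N]|.

(* The test c <= 2j+1 gives binomials with a negative lower index the value 0;
   without it the truncated subtraction on nat would yield 'C(m, 0) = 1. *)
Definition batch_matrix (R : realType) (m : nat) : 'M[R]_m :=
  \matrix_(j, c)
    (if c == 0 :> nat then binom_ge m (2 * j + 1)
     else if c <= 2 * j + 1 then 'C(m, 2 * j + 1 - c) else 0)%N%:R.

(* The set of real eigenvalues is finite, and for m > 0 it is nonempty because
   the spectral radius of an entrywise nonnegative matrix is an eigenvalue; so
   the supremum is the largest element of the set. *)
Definition batch_lambda (R : realType) (m : nat) : R :=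
  sup [set a : R | eigenvalue (batch_matrix R m) a]%classic.

Definition log2 (R : realType) (x : R) : R := ln x / ln 2.

(* Main.v *)
Require Import Defs.
From mathcomp Require Import zify ring lra finfield.

(* Let q = 2 ^ l and r = 2 ^ s.  The code consists of the binary functions on
   F_q ^ m whose restriction to each line, seen as a polynomial of degree < q,
   has degree < q - r: on each line r checks hold, so a value can be read off
   any q - r other points of a line through it.  As a point lies on more than
   q ^ (m - 1) lines, a greedy choice of lines serves r q ^ (m - 2) requests.
   Over F_q the checks are orthogonal to every monomial that no line can turn
   into one of degree >= q - r; the other monomials are recognized, bit by bit
   from the most significant one, by an automaton with transition matrix A_m,
   so there are O(2 ^ (m s) lambda ^ (l - s)) of them.  This bounds the binary
   rank of the checks directly if s = 0 (they are then binary), and after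
   multiplication by l in general; the factor l is absorbed by delta.  Taking
   s close to (m eps - m + 2) l gives the exponent. *)

Set Implicit Arguments.
Unset Strict Implicit.
Unset Printing Implicit Defensive.

Import Order.TTheory GRing.Theory Num.Theory.
Local Open Scope ring_scope.

(** * Spectral bounds *)

(** A Collatz-Wielandt certificate: for an entrywise non-negative [A], such a [u] exists exactly
    when every real eigenvalue of [A] is below [t]. *)
Definition left_subinvariant (R : realType) (n : nat) (A : 'M[R]_n) (t : R) :=
  exists u : 'rV[R]_n,
    (forall j, 0 < u 0 j) /\ (forall j, (u *m A) 0 j < t * u 0 j).

Lemma left_subinvariant_le (R : realType) n (A : 'M[R]_n) (t t' : R) :
  t <= t' -> left_subinvariant A t -> left_subinvariant A t'.
Proof.
move=> tt' [u [u0 uA]]; exists u; split=> // j.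
by apply: lt_le_trans (uA j) _; rewrite ler_wpM2r // ltW.
Qed.

Lemma left_subinvariant_large (R : realType) n (A : 'M[R]_n) :
  (forall i j, 0 <= A i j) -> left_subinvariant A (1 + \sum_i \sum_j A i j).
Proof.
move=> A0; exists (const_mx 1); split=> [j|j]; first by rewrite mxE.
rewrite !mxE mulr1; apply: le_lt_trans (ltr_pwDl ltr01 (lexx _)).
apply: ler_sum => i _; rewrite mxE mul1r (bigD1 j) //= lerDl.
by apply: sumr_ge0.
Qed.

(* Minimum principle: compare x with u at the index minimizing x_i / u_i. *)
Lemma left_subinvariant_monotone (R : realType) n (A : 'M[R]_n) (t : R)
    (x : 'rV[R]_n) :
  (forall i j, 0 <= A i j) -> left_subinvariant A t ->
  (forall j, (x *m A) 0 j <= t * x 0 j) -> forall j, 0 <= x 0 j.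
Proof.
move=> A0 [u [u0 uA]] xA j0.
have [i _ imin] := @arg_minP _ _ _ j0 predT (fun i => x 0 i / u 0 i) isT.
set c := x 0 i / u 0 i in imin.
have cu j : c * u 0 j <= x 0 j by rewrite -ler_pdivlMr // imin.
suff c0 : 0 <= c by apply: le_trans (cu j0); rewrite mulr_ge0 // ltW.
rewrite leNgt; apply/negP => c0.
have xi : x 0 i = c * u 0 i by rewrite divfK // gt_eqF.
have := xA i; rewrite leNgt => /negP[]; rewrite xi mulrCA.
apply: (@lt_le_trans _ _ (c * (u *m A) 0 i)); first by rewrite ltr_nM2l.
rewrite !mxE mulr_sumr; apply: ler_sum => k _.
by rewrite mulrA ler_wpM2r.
Qed.

(** If [a >= t], the minimum principle at level [a] applies to both [x] and [- x], so [x = 0]. *)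
Lemma eigenvalue_lt_subinvariant (R : realType) n (A : 'M[R]_n) (t a : R) :
  (forall i j, 0 <= A i j) -> left_subinvariant A t -> eigenvalue A a -> a < t.
Proof.
move=> A0 At /eigenvalueP[x xA x_neq0]; rewrite ltNge; apply/negP => ta.
have Aa := left_subinvariant_le ta At.
have x0 j : 0 <= x 0 j.
  by apply: (left_subinvariant_monotone A0 Aa) => k; rewrite xA mxE.
have Nx0 j : 0 <= (- x) 0 j.
  apply: (left_subinvariant_monotone A0 Aa) => k.
  by rewrite mulNmx xA !mxE mulrN.
case/eqP: x_neq0; apply/rowP=> j; rewrite mxE.
by apply/eqP; rewrite eq_le x0 -oppr_ge0 andbT; have := Nx0 j; rewrite mxE.
Qed.

(* If not, let s >= t be the supremum of the levels that are not subinvariant.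
   Then s is no eigenvalue, so v (s - A) = 1 has a solution v; monotonicity
   just above s gives v >= 0, and v shows that s - eta is subinvariant. *)
Lemma subinvariant_of_eigenvalue_lt (R : realType) n (A : 'M[R]_n) (t : R) :
  (forall i j, 0 <= A i j) -> (forall a, eigenvalue A a -> a < t) ->
  left_subinvariant A t.
Proof.
move=> A0 eigA; apply: contrapT => Nt.
pose S := [set s : R | ~ left_subinvariant A s]%classic.
have Sub : has_ubound S.
  exists (1 + \sum_i \sum_j A i j) => s /= Ns; rewrite leNgt; apply/negP => ls.
  exact/Ns/(left_subinvariant_le (ltW ls))/left_subinvariant_large.
have Sne : (S !=set0)%classic by exists t.
have above s : sup S < s -> left_subinvariant A s.
  move=> ls; apply: contrapT => Ns.
  by have := ub_le_sup Sub Ns; rewrite leNgt ls.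
set s := sup S in above.
have ts : t <= s by exact: ub_le_sup.
have sU : A - s%:M \in unitmx.
  rewrite -row_free_unit -kermx_eq0; apply: contraT => eig_s.
  by have := eigA s eig_s; rewrite ltNge ts.
pose v : 'rV[R]_n := - (const_mx 1 *m invmx (A - s%:M)).
have vA j : (v *m A) 0 j = s * v 0 j - 1.
  have : v *m (A - s%:M) = - const_mx 1 by rewrite mulNmx mulmxKV.
  rewrite mulmxBr mul_mx_scalar => /rowP/(_ j).
  rewrite [LHS]mxE [X in _ + X]mxE [RHS]mxE [X in _ = - X]mxE.
  by move=> /(canRL (subrK _)) ->; rewrite addrC mxE.
pose b := 1 + \sum_j `|v 0 j|.
have b_gt0 : 0 < b by rewrite ltr_pwDl // sumr_ge0.
have vb j : `|v 0 j| <= b.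
  rewrite /b (bigD1 j) //= addrCA lerDl addr_ge0 //.
  by rewrite sumr_ge0.
have b1_gt0 : 0 < b + 1 by apply: addr_gt0.
pose eta := (b + 1)^-1.
have eta_gt0 : 0 < eta by rewrite invr_gt0.
have etav j : eta * `|v 0 j| < 1.
  rewrite /eta ltr_pdivrMl // mulr1.
  by apply: le_lt_trans (vb j) _; rewrite ltrDl.
have v_ge0 j : 0 <= v 0 j.
  have As : left_subinvariant A (s + eta) by apply: above; rewrite ltrDl.
  apply: (left_subinvariant_monotone A0 As) => k.
  rewrite vA mulrDl lerD2l; apply: (@le_trans _ _ (- (eta * `|v 0 k|))).
    by rewrite lerN2 ltW.
  by rewrite -mulrN ler_pM2l // lerNl -normrN ler_norm.
have v_gt0 j : 0 < v 0 j.
  rewrite lt_neqAle v_ge0 andbT; apply/eqP => v0.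
  have : 0 <= (v *m A) 0 j by rewrite mxE sumr_ge0 // => k _; rewrite mulr_ge0.
  by rewrite vA -v0 mulr0 sub0r oppr_ge0 ler10.
have As : left_subinvariant A (s - eta).
  exists v; split=> // j; rewrite vA mulrBl ltrD2l ltrN2.
  by have := etav j; rewrite ger0_norm.
have : s <= s - eta.
  apply: ge_sup Sne _ => r /= Nr; rewrite leNgt; apply/negP => lr.
  exact/Nr/(left_subinvariant_le (ltW lr)).
by rewrite lerDl oppr_ge0 leNgt eta_gt0.
Qed.

(** * The matrix $A_m$ and the bounds $2\le\lambda_m<2^m$ *)

(** Truncated subtraction unifies the two kinds of columns: column $0$ collects every [S] with at
    least [2 * j + 1] elements. *)
Lemma batch_matrixE (R : realType) m (j c : 'I_m) :
  batch_matrix R m j c =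
    #|[set S : {set 'I_m} | (2 * j + 1 - #|S|)%N == c]|%:R.
Proof.
rewrite mxE; congr (_%:R); case: eqP => [-> | c_neq0].
  by apply: eq_card => S; rewrite !inE -subn_eq0.
case: leqP => cj; last first.
  by apply/esym/eqP; rewrite cards_eq0; apply/eqP/setP => S; rewrite !inE; lia.
rewrite -[X in 'C(X, _)]card_ord -card_draws.
apply: eq_card => S; rewrite !inE;
  move: #|S| (nat_of_ord c) (nat_of_ord j) c_neq0 cj => s c' j' *.
by apply/eqP/eqP; lia.
Qed.

Lemma batch_matrix_ge0 (R : realType) m (j c : 'I_m) : 0 <= batch_matrix R m j
  c.
Proof. by rewrite batch_matrixE. Qed.

(** Row [j] of $A_m$ counts the moves from [j] to [2 * j + 1 - #|S|] over all subsets [S]; moves to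
    states [>= m] are dropped. *)
Lemma batch_matrix_sum (R : realType) m (j : 'I_m) (g : nat -> R) :
  \sum_c batch_matrix R m j c * g c =
    \sum_(S : {set 'I_m} | (2 * j + 1 - #|S| < m)%N) g (2 * j + 1 - #|S|)%N.
Proof.
case: m j => [|m] j; first by case: j.
rewrite [RHS](partition_big
  (fun S : {set 'I_m.+1} => inord (2 * j + 1 - #|S|) : 'I_m.+1) predT) //=.
apply: eq_bigr => c _; rewrite batch_matrixE.
rewrite (eq_bigl (mem [set S : {set 'I_m.+1} | (2 * j + 1 - #|S|)%N == c])).
  rewrite (eq_bigr (fun=> g c)) => [|S]; last by rewrite !inE => /eqP->.
  by rewrite sumr_const mulr_natl.
move=> S; rewrite !inE /=; apply/andP/eqP => [[lt_m /eqP<-]|eq_c].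
  by rewrite inordK.
by split; [rewrite eq_c ltn_ord | apply/eqP/val_inj; rewrite /= inordK ?eq_c].
Qed.

Lemma card_sets m : #|{set 'I_m}| = (2 ^ m)%N.
Proof. by rewrite -cardsT -powersetT card_powerset cardsT card_ord. Qed.

Lemma batch_matrix_le (R : realType) m (j c : 'I_m) :
  batch_matrix R m j c <= 2 ^+ m.
Proof. by rewrite batch_matrixE -natrX ler_nat -card_sets max_card. Qed.

Lemma batch_matrix_ge1 (R : realType) m (j c : 'I_m) :
  (c <= 2 * j + 1)%N -> (2 * j + 1 - c <= m)%N -> 1 <= batch_matrix R m j c.
Proof.
move=> cj jm; rewrite batch_matrixE ler1n card_gt0; apply/set0Pn.
have : (0 < #|[set S : {set 'I_m} | #|S| == (2 * j + 1 - c)%N]|)%N.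
  by rewrite card_draws card_ord bin_gt0.
by rewrite card_gt0 => /set0Pn[S]; rewrite inE => /eqP Sc; exists S;
  rewrite inE Sc; lia.
Qed.

Lemma batch_lambda_subinvariant (R : realType) m (t : R) :
  batch_lambda R m < t -> left_subinvariant (batch_matrix R m) t.
Proof.
move=> lt_t; apply: subinvariant_of_eigenvalue_lt (@batch_matrix_ge0 R m) _.
move=> a eig_a; apply: le_lt_trans lt_t; apply: ub_le_sup eig_a.
exists (1 + \sum_i \sum_j batch_matrix R m i j) => b eig_b.
exact/ltW/(eigenvalue_lt_subinvariant (@batch_matrix_ge0 R m) _ eig_b)
  /left_subinvariant_large/(@batch_matrix_ge0 R m).
Qed.

(** The diagonal entry at $0$ counts the nonempty sets, so it is $2^m-1\ge 3$, and a level of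
    subinvariance exceeds every diagonal entry. *)
Lemma batch_lambda_ge2 (R : realType) m : (1 < m)%N -> 2 <= batch_lambda R m.
Proof.
move=> m_gt1; rewrite leNgt; apply/negP => /batch_lambda_subinvariant[u [u0
  uA]].
have m_gt0 : (0 < m)%N by lia.
pose o := Ordinal m_gt0; have := uA o; rewrite ltNge => /negP[].
rewrite mxE (bigD1 o) //= ler_wpDr //.
  by apply: sumr_ge0 => i _; rewrite mulr_ge0 ?batch_matrix_ge0 ?ltW.
rewrite [leRHS]mulrC ler_pM2r // batch_matrixE ler_nat.
rewrite (_ : [set S | _] = [set~ (finset.set0 : {set 'I_m})]); last first.
  by apply/setP => S; rewrite !inE -cards_eq0 /=; lia.
rewrite cardsC1 card_sets.
by have := leq_pexp2l (isT : (0 < 2)%N) m_gt1; lia.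
Qed.

(** This makes $m-\log\lambda_m$ positive. A positive column vector [v] with $Av\le(2^m-\eta)v$
    bounds every eigenvalue. It can be taken decreasing in the state, since from each state some
    move goes one state up or leaves the range. *)
Lemma batch_lambda_lt (R : realType) m : (1 < m)%N -> batch_lambda R m < 2 ^+ m.
Proof.
move=> m_gt1; set A := batch_matrix R m.
(* With $x=M^{-(m-j)}$, the move to [j.+1] loses $Mx=2^mx+x$, and the surplus $x\ge\eta$ pays for
   the improvement [eta]. *)
pose M : R := 2 ^+ m + 1.
have M_ge1 : 1 <= M by rewrite /M lerDr exprn_ge0.
have M_gt0 : 0 < M by apply: lt_le_trans M_ge1.
pose v (j : nat) : R := 1 - M ^- (m - j).
pose eta : R := M ^- m.
have eta_gt0 : 0 < eta by rewrite invr_gt0 exprn_gt0.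
have Mk k : 0 < M ^- k by rewrite invr_gt0 exprn_gt0.
have Mmono k k' : (k <= k')%N -> M ^- k' <= M ^- k.
  by move=> kk'; rewrite lef_pV2 ?posrE ?exprn_gt0 // ler_weXn2l.
have M1 : M ^-1 < 1.
  by rewrite invf_lt1 // /M ltrDr exprn_gt0.
have v_gt0 j : (j < m)%N -> 0 < v j.
  move=> jm; rewrite subr_gt0; apply: le_lt_trans M1.
  by rewrite -[leRHS]expr1 exprVn Mmono // subn_gt0.
have v_le1 j : v j <= 1 by rewrite gerBl ltW.
have M2 : 2 <= 2 ^+ m :> R.
  by rewrite -[leLHS]expr1 ler_weXn2l ?ler1n // ltnW.
have eta1 : eta < 1.
  by apply: le_lt_trans M1; rewrite -[leRHS]expr1 exprVn Mmono // ltnW.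
have Av (j : 'I_m) : \sum_c A j c * v c <= (2 ^+ m - eta) * v j.
  rewrite batch_matrix_sum big_mkcond /=.
  have [jm|jm] := ltnP j.+1 m; last first.
    rewrite (bigD1 [set: 'I_m]) //= big1 ?addr0; last first.
      move=> S ST; case: ifP => // lt_m; exfalso.
      have : (#|S| < m)%N.
        by rewrite -[ltnRHS]card_ord -cardsT proper_card // properT.
      by have := ltn_ord j; move: lt_m; move: #|S| => s; lia.
    rewrite cardsT card_ord; have -> : (2 * j + 1 - m)%N = j by have := ltn_ord
      j; lia.
    rewrite ltn_ord ler_peMl ?ltW ?v_gt0 //.
    by lra.
  have : (0 < #|[set S : {set 'I_m} | #|S| == j :> nat]|)%N.
    by rewrite card_draws card_ord bin_gt0 ltnW.
  rewrite card_gt0 => /set0Pn[S]; rewrite inE => /eqP Sj.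
  rewrite (bigD1 S) //= Sj; have -> : (2 * j + 1 - j)%N = j.+1 by lia.
  rewrite jm.
  apply: (@le_trans _ _ (v j.+1 + \sum_(T : {set 'I_m} | T != S) 1)).
    rewrite lerD2l; apply: ler_sum => T _; case: ifP => // _.
  have -> : \sum_(T : {set 'I_m} | T != S) (1 : R) = 2 ^+ m - 1.
    rewrite (eq_bigl (mem (predC1 S))) // sumr_const cardC1 card_sets.
    by rewrite -subn1 natrB ?expn_gt0 // natrX.
  have e : M ^- (m - j.+1) = (2 ^+ m + 1) * M ^- (m - j).
    have -> : (m - j = (m - j.+1).+1)%N by lia.
    by rewrite exprS invfM mulrA divff ?mul1r // gt_eqF.
  rewrite /v e mulrBl mulrBr mulr1; move: (Mmono _ _ (leq_subr j m));
    rewrite -/eta.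
  by have := v_le1 j; move: (Mk (m - j)%N); rewrite /v; set x := M ^- _; nra.
(* Pairing $|x|$ with [v] gives $|a|\sum_j|x_j|v_j\le\sum_i|x_i|(Av)_i$. *)
have eig_le a : eigenvalue A a -> a <= 2 ^+ m - eta.
  move=> /eigenvalueP[x xA x_neq0].
  have [k xk] : exists k, x 0 k != 0.
    apply/existsP; apply: contraT; rewrite negb_exists => /forallP x0.
    case/eqP: x_neq0; apply/rowP => k; rewrite mxE.
    by have := x0 k; rewrite negbK => /eqP.
  have : 0 < \sum_j `|x 0 j| * v j.
    rewrite (bigD1 k) //= ltr_pwDl ?mulr_gt0 ?normr_gt0 ?v_gt0 //.
    by apply: sumr_ge0 => i _; rewrite mulr_ge0 // ltW // v_gt0.
  move=> sum_gt0; apply: le_trans (ler_norm a) _.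
  rewrite -(ler_pM2r sum_gt0) !mulr_sumr.
  apply: (@le_trans _ _ (\sum_j \sum_i `|x 0 i| * A i j * v j)).
    apply: ler_sum => j _; rewrite mulrA -normrM -mulr_suml.
    apply: ler_wpM2r; first exact/ltW/v_gt0.
    have -> : a * x 0 j = (x *m A) 0 j by rewrite xA mxE.
    rewrite mxE; apply: le_trans (ler_norm_sum _ _ _) _; apply: ler_sum => i _.
    by rewrite normrM (ger0_norm (batch_matrix_ge0 _ _ _)).
  rewrite exchange_big /=; apply: ler_sum => i _.
  rewrite mulrCA; under eq_bigr do rewrite -mulrA.
  by rewrite -mulr_sumr ler_wpM2l.
apply: (@le_lt_trans _ _ (2 ^+ m - eta)); last by rewrite ltrBlDr ltrDl.
(* Without real eigenvalues the supremum would be the default $0$, which is also below $2^m$. *)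
have [[a eig_a]|/set0P/negP] := pselect ([set a | eigenvalue A a]%classic
  !=set0)%classic.
  by apply: ge_sup => //; exists a.
by rewrite negbK => /eqP e; rewrite /batch_lambda e sup0; lra.
Qed.

(* Number of words S_1 ... S_L of subsets of 'I_m along which the greedy state
   j |-> 2 j + 1 - #|S| (truncated at 0) starting from j ends below m. *)
Fixpoint surviving (m L j : nat) : nat :=
  if L is L'.+1 then
    (\sum_(S : {set 'I_m}) surviving m L' (2 * j + 1 - #|S|))%N
  else (j < m)%N.

Lemma surviving_ge m L j : (m <= j)%N -> surviving m L j = 0%N.
Proof.
elim: L j => [|L IH] j mj /=; first by rewrite ltnNge mj.
rewrite big1 // => S _; apply: IH.
by have := max_card (mem S); rewrite card_ord; move: #|S| => k; lia.
Qed.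

Lemma surviving_rec (R : realType) m L (j : 'I_m) :
  (surviving m L.+1 j)%:R =
    \sum_c batch_matrix R m j c * (surviving m L c)%:R.
Proof.
rewrite (batch_matrix_sum j (fun c => (surviving m L c)%:R)) /= natr_sum.
rewrite [RHS]big_mkcond; apply: eq_bigr => S _.
by case: ltnP => // /surviving_ge->.
Qed.

(** The counts form the vector $A_m^L\mathbf 1$, so this is $uA_m^L\mathbf 1\le t^Lu\mathbf 1$. *)
Lemma surviving_subinvariant (R : realType) m (t : R) (u : 'rV[R]_m) L :
  0 <= t -> (forall j, 0 <= u 0 j) ->
  (forall j, (u *m batch_matrix R m) 0 j <= t * u 0 j) ->
  \sum_(j < m) u 0 j * (surviving m L j)%:R <= t ^+ L * \sum_(j < m) u 0 j.
Proof.
move=> t0 u0 uA; elim: L => [|L IH].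
  rewrite expr0 mul1r; apply: ler_sum => j _ /=.
  by rewrite ltn_ord mulr1.
rewrite exprS -mulrA; apply: le_trans (ler_wpM2l t0 IH).
under eq_bigr => j _ do rewrite surviving_rec mulr_sumr.
rewrite exchange_big mulr_sumr; apply: ler_sum => c _ /=.
under eq_bigr => j _ do rewrite mulrA.
by rewrite -mulr_suml mulrA ler_wpM2r //; have := uA c; rewrite mxE.
Qed.

(* The state m-1 only leads to itself, the other states form an irreducible
   block; so the ratios of the entries of a subinvariant vector other than the
   last one are bounded, and the last one can be replaced by a constant. *)
Lemma surviving_le_subinvariant (R : realType) m (t T : R) L :
  (1 < m)%N -> 2 <= t -> t <= T -> left_subinvariant (batch_matrix R m) t ->
  \sum_(j < m) (surviving m L j)%:R <=
    T ^+ m * m%:R * (m%:R * (2 ^+ m * T ^+ m)) * t ^+ L.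
Proof.
move=> m_gt1 t2 tT [u [u0 uA]]; set A := batch_matrix R m in uA.
have t_gt0 : 0 < t by lra.
have T_ge1 : 1 <= T by lra.
have T_gt0 : 0 < T by lra.
(* A positive entry of $A_m$ is at least $1$, so each possible move from [j] to [c] bounds [u 0 j]
   by [T * u 0 c]. *)
have step (j c : 'I_m) : (c <= 2 * j + 1)%N -> (2 * j + 1 - c <= m)%N ->
    u 0 j <= T * u 0 c.
  move=> cj jm; apply: (@le_trans _ _ (t * u 0 c)); last by rewrite ler_pM2r.
  apply: le_trans (ltW (uA c)); rewrite mxE (bigD1 j) //=.
  rewrite -[leLHS]addr0 lerD //.
    by rewrite ler_peMr ?(ltW (u0 _)) // batch_matrix_ge1.
  by apply: sumr_ge0 => i _; rewrite mulr_ge0 ?batch_matrix_ge0 ?(ltW (u0 _)).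
have m_gt0 : (0 < m)%N by lia.
pose o := Ordinal m_gt0.
(* A set of size [j] moves [j] to [j.+1]; a move back by one needs [j + 3] elements and is
   impossible only out of the last state. *)
have lower (j : nat) (jm : (j < m)%N) : u 0 o <= T ^+ j * u 0 (Ordinal jm).
  elim: j jm => [|j IH] jm.
    by rewrite expr0 mul1r (_ : Ordinal jm = o) //; apply/val_inj.
  apply: le_trans (IH (ltnW jm)) _.
  by rewrite exprSr -mulrA ler_pM2l ?exprn_gt0 // step //=; lia.
have upper (j : nat) (jm : (j < m)%N) : (j.+1 < m)%N ->
    u 0 (Ordinal jm) <= T ^+ j * u 0 o.
  elim: j jm => [|j IH] jm jm1.
    by rewrite expr0 mul1r (_ : Ordinal jm = o) //; apply/val_inj.
  apply: (@le_trans _ _ (T * u 0 (Ordinal (ltnW jm)))).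
    by apply: step => /=; lia.
  by rewrite exprS -mulrA ler_pM2l // IH.
have Tj (j : nat) : (j < m)%N -> T ^+ j <= T ^+ m.
  by move=> jm; rewrite ler_weXn2l // ltnW.
(* [K] bounds the total contribution of the other states to the last column; with the diagonal entry
   $1$ that column is at most $2K\le tK$. *)
pose K : R := m%:R * (2 ^+ m * T ^+ m).
have Tm1 : 1 <= T ^+ m by rewrite exprn_ege1.
have m1 : 1 <= m%:R :> R by rewrite ler1n.
have p1 : 1 <= 2 ^+ m :> R by rewrite exprn_ege1 // ler1n.
have K_ge : T ^+ m <= K.
  by rewrite /K mulrA ler_peMl ?(le_trans ler01) // -[leLHS]mulr1 ler_pM.
have K_ge1 : 1 <= K by apply: le_trans K_ge.
pose w : 'rV[R]_m := \row_j (if (j.+1 < m)%N then u 0 j / u 0 o else K).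
have w_le j : w 0 j <= K.
  rewrite mxE; case: ifP => // jm; apply: le_trans K_ge.
  rewrite ler_pdivrMr //; case: j jm => j jm /= jm1.
  by apply: le_trans (upper j jm jm1) _; rewrite ler_pM2r // Tj.
have w_ge j : 1 <= T ^+ m * w 0 j.
  rewrite mxE; case: ifP => jm; last by rewrite -[leLHS]mulr1 ler_pM.
  rewrite mulrA ler_pdivlMr // mul1r; case: j jm => j jm /= jm1.
  by apply: le_trans (lower j jm) _; rewrite ler_pM2r // Tj.
have w_ge0 j : 0 <= w 0 j.
  by have := le_trans ler01 (w_ge j); rewrite pmulr_rge0 // exprn_gt0.
have wA j : (w *m A) 0 j <= t * w 0 j.
  rewrite [leLHS]mxE; have [jm|jm] := ltnP j.+1 m.
    rewrite [w 0 j]mxE jm mulrA ler_pdivlMr // mulr_suml.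
    apply: le_trans (ltW (uA j)); rewrite mxE; apply: ler_sum => i _.
    rewrite mxE; case: ifP => im; first by rewrite mulrAC divfK // gt_eqF.
    suff -> : A i j = 0 by rewrite !mulr0 mul0r.
    rewrite /A batch_matrixE; apply/eqP; rewrite pnatr_eq0 cards_eq0.
    apply/eqP/setP => S; rewrite !inE; apply/negbTE/eqP.
    have := max_card (mem S); rewrite card_ord; have := ltn_ord i.
    by move: #|S| im jm => k; clear; lia.
  have wj : w 0 j = K by rewrite mxE ltnNge jm.
  rewrite (bigD1 j) //= wj.
  have Ajj : A j j <= 1.
    rewrite /A batch_matrixE lern1 -[leqRHS](cards1 [set: 'I_m]).
    apply/subset_leq_card/fintype.subsetP => S; rewrite !inE => /eqP Sj.
    rewrite eqEcard finset.subsetT cardsT card_ord /=.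
    by have := ltn_ord j; move: Sj jm m_gt1; move: #|S| => k; clear; lia.
  have sum_le : \sum_(i < m | i != j) w 0 i * A i j <= K.
    apply: (@le_trans _ _ (\sum_(i < m) T ^+ m * 2 ^+ m)); last first.
      by rewrite sumr_const card_ord /K mulr_natl (mulrC (T ^+ m)).
    rewrite big_mkcond; apply: ler_sum => i _; case: ifP => ij; last first.
      by rewrite mulr_ge0 ?(le_trans ler01).
    rewrite ler_pM ?batch_matrix_ge0 ?batch_matrix_le // mxE ifT; last first.
      move: ij; rewrite -val_eqE /=; have := ltn_ord i; have := ltn_ord j.
      by move: jm; clear; lia.
    rewrite ler_pdivrMr //; case: i ij => i im /= ij.
    apply: le_trans (upper i im _) _; last by rewrite ler_pM2r // Tj.
    by move: ij; rewrite -val_eqE /=; have := ltn_ord j; move: jm im; clear;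
      lia.
  have KA : K * A j j <= K by rewrite ler_piMr // (le_trans ler01).
  apply: le_trans (lerD KA sum_le) _.
  by rewrite -mulr2n -mulr_natl ler_pM2r // (lt_le_trans ltr01).
have t0 := ltW t_gt0.
apply: (@le_trans _ _ (\sum_(j < m) T ^+ m * (w 0 j * (surviving m L j)%:R))).
  by apply: ler_sum => j _; rewrite mulrA ler_peMl.
rewrite -mulr_sumr -!mulrA ler_wpM2l ?(le_trans ler01 Tm1) //.
apply: le_trans (surviving_subinvariant L t0 w_ge0 wA) _.
rewrite mulrC !mulrA ler_wpM2r ?exprn_ge0 // -!mulrA -/K.
by rewrite mulr_natl -[m in leRHS]card_ord -sumr_const; apply: ler_sum.
Qed.

(* Apply the previous bound with t = lambda (1 + 1 / (L + 1)): then
   t ^ L <= e * lambda ^ L, so no polynomial factor is lost. *)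
Lemma surviving_le (R : realType) m : (1 < m)%N ->
  exists2 C : R, 0 < C & forall L,
    \sum_(j < m) (surviving m L j)%:R <= C * batch_lambda R m ^+ L.
Proof.
move=> m_gt1; set lam := batch_lambda R m.
have lam2 : 2 <= lam := batch_lambda_ge2 R m_gt1.
have lam_gt0 : 0 < lam by lra.
have m0 : 0 < m%:R :> R by rewrite ltr0n; lia.
pose T := 2 * lam.
have T0 : 0 < T by rewrite mulr_gt0.
pose K := T ^+ m * m%:R * (m%:R * (2 ^+ m * T ^+ m)).
have K0 : 0 < K by rewrite !mulr_gt0 ?exprn_gt0.
exists (K * expR 1) => [|L]; first by rewrite mulr_gt0 ?expR_gt0.
pose t := lam * (1 + L.+1%:R^-1).
have /andP[iL0 iL1] : 0 < (L.+1%:R^-1 : R) <= 1.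
  by rewrite invr_gt0 ltr0n invf_le1 ?ltr0n ?ler1n.
have lt_t : lam < t by rewrite ltr_pMr // ltrDl.
have tT : t <= T.
  rewrite /t /T mulrDr mulr1 mulr_natl mulr2n lerD2l.
  by rewrite ler_piMr // ltW.
have := @surviving_le_subinvariant R m t T L m_gt1 _ tT.
move=> /(_ _ (batch_lambda_subinvariant lt_t)) le1.
apply: le_trans (le1 _) _; first by lra.
rewrite -/K -mulrA ler_pM2l // /t exprMn mulrC ler_pM2r ?exprn_gt0 //.
apply: (@le_trans _ _ (expR L.+1%:R^-1 ^+ L)).
  apply: lerXn2r; rewrite ?nnegrE ?expR_ge0 ?expR_ge1Dx //.
rewrite -expRM_natl ler_expR mulrC.
by rewrite ler_pdivrMl ?ltr0n // mulr1 ler_nat.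
Qed.

(** * Counting the bad monomials *)

Local Open Scope nat_scope.

Lemma sum_tupleS (T : finType) n (F : n.+1.-tuple T -> nat) :
  \sum_t F t = \sum_x \sum_(t : n.-tuple T) F (cons_tuple x t).
Proof.
rewrite pair_big /= (reindex (fun p : T * n.-tuple T => cons_tuple p.1 p.2))
  //=.
exists (fun t => (thead t, behead_tuple t)) => [[x t] _|t _] /=.
  by rewrite theadE; congr (_, _); apply/val_inj.
by rewrite [RHS]tuple_eta; apply/val_inj.
Qed.

Definition greedy (j : nat) (ws : seq nat) : nat :=
  foldl (fun j w => 2 * j + 1 - w) j ws.

(** The last [s] letters are free, whence the factor $2^{ms}$. *)
Lemma sum_greedy_lt m L s j :
  \sum_(a : (L + s).-tuple {set 'I_m})
     (greedy j (take L [seq #|B| | B : {set 'I_m} <- a]) < m) =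
  2 ^ (m * s) * surviving m L j.
Proof.
elim: L j => [|L IH] j.
  under eq_bigr => a _ do rewrite take0.
  by rewrite sum_nat_const card_tuple card_sets -expnM.
rewrite sum_tupleS big_distrr /=; apply: eq_bigr => S _.
by rewrite -IH.
Qed.

(** Base two, most significant digit first; digits may exceed $1$, since a digit will be the number
    of variables using that bit. *)
Fixpoint bitval (us : seq nat) : nat :=
  if us is u :: us' then u * 2 ^ size us' + bitval us' else 0.

Lemma bitval_cat us vs : bitval (us ++ vs) = bitval us * 2 ^ size vs + bitval
  vs.
Proof.
elim: us => //= u us ->.
by rewrite size_cat expnD mulnDl mulnA addnA.
Qed.

Lemma bitval_le m us :
  all (leq^~ m) us -> bitval us + m <= m * 2 ^ size us.
Proof.
elim: us => [|u us IH] /=; first by rewrite muln1.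
case/andP=> um /IH; rewrite expnS; have : 0 < 2 ^ size us by rewrite expn_gt0.
by move: (2 ^ size us) => x; nia.
Qed.

Lemma bitval_enum l (g : 'I_l -> nat) :
  bitval [seq g c | c <- enum 'I_l] = \sum_c g c * 2 ^ (l - c.+1).
Proof.
elim: l g => [|l IH] g; first by rewrite big_ord0 enum_ord0.
rewrite enum_ordSl /= big_ord_recl -map_comp IH size_map size_enum_ord subn1.
by congr (_ + _); apply: eq_bigr => c _ /=; rewrite /bump /= add1n subSS.
Qed.

Lemma leq_greedy j k ws : j <= k -> greedy j ws <= greedy k ws.
Proof. by elim: ws j k => //= w ws IH j k jk; apply: IH; lia. Qed.

(* D + 1 is the demand, in units of the current bit, that the remaining bits
   have to fill; taking all available bits keeps it minimal. *)
Lemma greedy_lt us ws D y :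
  all2 leq us ws -> bitval us + y = D.+1 * 2 ^ size us -> 0 < y ->
  greedy D ws < y.
Proof.
elim: us ws D => [|u us IH] [|w ws] D //=; first by rewrite add0n muln1 => _ ->.
case/andP=> uw uws; rewrite expnS => e y0.
have uD : u <= 2 * D + 1.
  by rewrite leqNgt; apply/negP => lt_u; move: e; move: (2 ^ size us) => x; nia.
apply: leq_ltn_trans (IH ws (2 * D + 1 - u) uws _ y0);
  first by apply: leq_greedy; lia.
by move: e uD; move: (2 ^ size us) (bitval us) => x b; nia.
Qed.

(** Write $i+\mathrm{bitval}(us)=g_0(2^{L+s}-1)$; size bounds give $1\le g_0\le m$. The top [L]
    digits then fall short of $g_02^L$ by [y], where $y2^s$ is $g_0+i$ plus the value of the low
    digits, so $1\le y\le m$. The greedy bound applies with initial state $g_0-1$. *)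
Lemma greedy_of_dvd m L s us ws i :
  0 < L -> size us = L + s -> all2 leq us ws -> all (leq^~ m) us ->
  i < 2 ^ s -> 0 < i + bitval us -> (2 ^ (L + s)).-1 %| i + bitval us ->
  exists2 g, g < m & greedy g (take L ws) < m.
Proof.
move=> L0 sz uw um i_lt e_gt0 /dvdnP[g0 eg].
have g0_gt0 : 0 < g0 by case: g0 eg e_gt0 => // ->.
have q_gt0 : 0 < 2 ^ (L + s) by rewrite expn_gt0.
have sL : 2 * 2 ^ s <= 2 ^ (L + s) by rewrite -expnS leq_exp2l //; lia.
have g0m : g0 <= m.
  have := bitval_le um; rewrite sz.
  move: eg i_lt sL q_gt0 e_gt0; move: (2 ^ (L + s)) (2 ^ s) (bitval us) => Q x
    b; nia.
pose us1 := take L us; pose us2 := drop L us.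
have sz1 : size us1 = L by rewrite size_take sz; case: ltnP; lia.
have sz2 : size us2 = s by rewrite size_drop sz; lia.
have um2 : all (leq^~ m) us2.
  by move: um; rewrite -(cat_take_drop L us) all_cat => /andP[].
have uw1 : all2 leq us1 (take L ws).
  rewrite /us1; elim: {+}L us ws uw {sz um e_gt0 eg us1 us2 sz1 sz2 um2} => [|k
    IH] [|u us] [|w ws] //=.
  by case/andP=> -> /IH.
have := bitval_le um2; rewrite sz2 => b2.
have eb : bitval us = bitval us1 * 2 ^ s + bitval us2.
  by rewrite -{1}(cat_take_drop L us) bitval_cat -/us2 sz2.
have x_gt0 : 0 < 2 ^ s by rewrite expn_gt0.
pose y := g0 * 2 ^ L - bitval us1.
have ey : (bitval us2 + i + g0) = (g0 * 2 ^ L - bitval us1) * 2 ^ s.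
  rewrite mulnBl -mulnA -expnD; move: eg; rewrite eb -subn1 mulnBr muln1.
  have : g0 <= g0 * 2 ^ (L + s) by rewrite leq_pmulr.
  by lia.
have y_gt0 : 0 < y.
  by rewrite lt0n; apply/eqP => y0; move: ey; rewrite -/y y0; lia.
have ym : y <= m.
  by move: ey b2 i_lt g0m y_gt0; rewrite -/y;
    move: (2 ^ s) y (bitval us2) => x y' b; nia.
exists g0.-1; first by lia.
apply: leq_trans ym; apply: (greedy_lt uw1) => //.
by rewrite sz1 prednK // /y subnKC //; move: y_gt0; rewrite /y; lia.
Qed.

(* Monomials over a field with 2 ^ l elements: 'X_j gets the exponent
   \sum_(c in f j) 2 ^ (l - 1 - c), so bit 0 is the most significant one. *)
Definition bad_exponent (m l s : nat) (f : {ffun 'I_m -> {set 'I_l}}) : bool :=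
  [exists b : {ffun 'I_m -> {set 'I_l}}, exists i : 'I_(2 ^ s),
     let e := i + \sum_j \sum_(c in b j) 2 ^ (l - c.+1) in
     [&& [forall j, b j \subset f j], 0 < e & (2 ^ l).-1 %| e]].

Definition column (m l : nat) (f : {ffun 'I_m -> {set 'I_l}}) (c : 'I_l) :
  {set 'I_m} := [set j | c \in f j].

(** The word of columns determines [f], and the column sizes of a witness [b] are digits bounded by
    those of [f]. So each bad [f] survives from some state below [m]; the bound sums over these
    states. *)
Lemma card_bad_exponent m L s : 0 < L ->
  #|[set f : {ffun 'I_m -> {set 'I_(L + s)}} | bad_exponent s f]| <=
    2 ^ (m * s) * \sum_(j < m) surviving m L j.
Proof.
move=> L0; set B := [set f | _].
pose tr (f : {ffun 'I_m -> {set 'I_(L + s)}}) : (L + s).-tuple {set 'I_m} :=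
  [tuple column f c | c < L + s].
have tr_inj : injective tr.
  move=> f f' e; apply/ffunP => j; apply/setP => c.
  have : tnth (tr f) c = tnth (tr f') c by rewrite e.
  by rewrite !tnth_mktuple => /setP/(_ j); rewrite !inE.
rewrite -(card_imset _ tr_inj) big_distrr /=.
under eq_bigr => j _ do rewrite -sum_greedy_lt.
rewrite exchange_big -sum1_card big_mkcond; apply: leq_sum => a _ /=.
case: ifP => // /imsetP[f]; rewrite inE => /existsP[b /existsP[i]].
case/and3P=> /forallP bf e_gt0 e_dvd a_f.
have bs : \sum_j \sum_(c in b j) 2 ^ (L + s - c.+1) =
    bitval [seq #|column b c| | c <- enum 'I_(L + s)].
  rewrite bitval_enum; under eq_bigr do rewrite big_mkcond.
  rewrite exchange_big; apply: eq_bigr => c _ /=.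
  rewrite -big_mkcond sum_nat_const; congr (_ * _).
  by apply: eq_card => j; rewrite inE.
rewrite bs in e_gt0 e_dvd.
have [] := @greedy_of_dvd m L s _ [seq #|column f c| | c <- enum 'I_(L + s)] i
  L0 _ _ _ (ltn_ord i) e_gt0 e_dvd.
- by rewrite size_map size_enum_ord.
- elim: (enum _) => //= c cs ->; rewrite andbT; apply/subset_leq_card.
  by apply/fintype.subsetP => j; rewrite !inE; apply/fintype.subsetP.
- apply/allP => _ /mapP[c _ ->].
  by rewrite -[leqRHS]card_ord max_card.
move=> g gm lt_m; rewrite (bigD1 (Ordinal gm)) //=.
apply: leq_trans (leq_addr _ _); rewrite lt0b a_f.
by rewrite -map_comp.
Qed.

Local Open Scope ring_scope.

(** * Monomials and lines over a field with 2 ^ l elements *)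

(** Replacing [t] by [w * t] scales the sum by [w ^+ e]. So it vanishes unless every nonzero [w] is
    an [e]-th root of unity, which forces $q-1\mid e$; for [e = 0] the sum is $q=0$ in [F]. *)
Lemma power_sum_eq0 (F : finFieldType) (e : nat) :
  (#|F|%:R = 0 :> F) -> ~~ ((0 < e)%N && (#|F|.-1 %| e)%N) ->
  \sum_(t : F) t ^+ e = 0.
Proof.
move=> F0; case: (posnP e) => [-> _|e_gt0 /= ndvd].
  by under eq_bigr do rewrite expr0; rewrite sumr_const F0.
have card_gt1 : (0 < #|F|.-1)%N by rewrite -subn1 subn_gt0 finNzRing_gt1.
have fermat (t : F) : t != 0 -> t ^+ #|F|.-1 = 1.
  move=> t0; apply: (mulfI t0); rewrite mulr1 -exprS prednK ?expf_card //.
  exact: ltnW (finNzRing_gt1 F).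
have [w /andP[w0 we]|all1] := pickP (fun w : F => (w != 0) && (w ^+ e != 1)).
  set S := \sum_t _; have : w ^+ e * S = S.
    rewrite mulr_sumr [RHS](reindex_inj (mulfI w0)) /=.
    by apply: eq_bigr => t _; rewrite exprMn.
  move/eqP; rewrite -subr_eq0 -{2}(mul1r S) -mulrBl mulf_eq0 subr_eq0.
  by rewrite (negPf we) => /eqP.
have r_gt0 : (0 < e %% #|F|.-1)%N by rewrite lt0n; apply: contra ndvd.
have := @max_unity_roots F (e %% #|F|.-1) (enum (predC1 (0 : F))) r_gt0.
rewrite enum_uniq -cardE cardC1 leqNgt ltn_mod card_gt1 => few.
suff : ~~ true by []; apply: few => //; apply/allP => t;
  rewrite mem_enum !inE unity_rootE => t0.
have := all1 t; rewrite t0 /= => /negbFE/eqP.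
by rewrite {1}(divn_eq e #|F|.-1) exprD mulnC exprM fermat // expr1n mul1r =>
  ->.
Qed.

Definition monomial (F : finFieldType) (m l : nat)
    (f : {ffun 'I_m -> {set 'I_l}}) (x : {ffun 'I_m -> F}) : F :=
  \prod_j \prod_(c in f j) x j ^+ (2 ^ (l - c.+1)).

Definition line_point (F : finFieldType) (m : nat) (x v : {ffun 'I_m -> F})
    (t : F) : {ffun 'I_m -> F} := [ffun j => x j + t * v j].

Lemma frobenius2 (F : finFieldType) (x y : F) k :
  2%N \in [pchar F] -> (x + y) ^+ (2 ^ k) = x ^+ (2 ^ k) + y ^+ (2 ^ k).
Proof.
move=> ch; apply: exprDn_pchar; rewrite pnatX; apply/orP; left.
by rewrite pnatE.
Qed.

(** By additivity of Frobenius, expanding the monomial along the line produces only powers of [t]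
    whose exponents come from subsets of its bits. As [f] is good, none of these plus [i] is a
    positive multiple of $q-1$, so every power sum vanishes. *)
Lemma monomial_line_sum (F : finFieldType) (m l s : nat)
    (f : {ffun 'I_m -> {set 'I_l}}) (x v : {ffun 'I_m -> F}) (i : nat) :
  2%N \in [pchar F] -> #|F| = (2 ^ l)%N -> (0 < l)%N ->
  ~~ bad_exponent s f -> (i < 2 ^ s)%N ->
  \sum_t t ^+ i * monomial f (line_point x v t) = 0.
Proof.
move=> ch cF l_gt0 good i_lt.
pose I := ('I_m * 'I_l)%type; pose w (p : I) := (2 ^ (l - p.2.+1))%N.
pose inf (p : I) := p.2 \in f p.1.
pose G (p : I) := if inf p then x p.1 ^+ w p else 1.
pose H (p : I) := if inf p then v p.1 ^+ w p else 0.
have mE t : monomial f (line_point x v t) =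
    \sum_(J : {set I}) (\prod_p (if p \in J then H p else G p)) *
      t ^+ (\sum_(p in J) w p).
  pose H' t (p : I) := if inf p then t ^+ w p * v p.1 ^+ w p else 0.
  transitivity (\prod_p (H' t p + G p)).
    rewrite /monomial; under eq_bigr do rewrite big_mkcond.
    rewrite pair_big /=; apply: eq_bigr => p _; rewrite /H' /G /inf ffunE /w.
    by case: ifP => _; rewrite ?add0r // frobenius2 // exprMn addrC.
  rewrite bigA_distr; apply: eq_bigr => J _.
  rewrite expr_sum [X in _ * X]big_mkcond -big_split /=; apply: eq_bigr => p _.
  by rewrite /H' /H; case: ifP; rewrite ?mulr1 //; case: ifP;
    rewrite ?mul0r // mulrC.
under eq_bigr do rewrite mE mulr_sumr.
rewrite exchange_big big1 // => J _ /=.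
have [Jf|] := boolP [forall p in J, inf p]; last first.
  rewrite negb_forall => /existsP[p]; rewrite negb_imply => /andP[pJ pf].
  rewrite big1 // => t _; rewrite (bigD1 p) //= pJ /H (negPf pf).
  by rewrite !mul0r mulr0.
under eq_bigr do rewrite mulrCA -exprD.
rewrite -mulr_sumr power_sum_eq0 ?mulr0 //.
  by rewrite cF natrX (pcharf0 ch) expr0n eqn0Ngt l_gt0.
apply: contra good => ge; apply/existsP.
exists [ffun j => [set c | (j, c) \in J]]; apply/existsP; exists (Ordinal i_lt).
have -> : (\sum_j \sum_(c in [ffun j => [set c | (j, c) \in J]] j) 2 ^ (l -
  c.+1)
    = \sum_(p in J) w p)%N.
  rewrite [RHS]big_mkcond /=; under eq_bigr do rewrite big_mkcond.
  by rewrite pair_big; apply: eq_bigr => p _ /=;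
    rewrite ffunE inE -surjective_pairing.
move: ge; rewrite cF => /andP[e_gt0 e_dvd]; apply/and3P; split=> //.
apply/forallP => j; rewrite ffunE.
by apply/fintype.subsetP => c; rewrite inE => /(forall_inP Jf).
Qed.

Lemma sum_bits l : (\sum_(c < l) 2 ^ (l - c.+1) = (2 ^ l).-1)%N.
Proof. by rewrite predn_exp mul1n [RHS](reindex_inj rev_ord_inj). Qed.

(** The indicator of [p] is $\prod_j(1-(x_j-p_j)^{q-1})$. Since $q-1$ is the sum of all bit weights,
    Frobenius expands each factor; [k a A] is the coefficient of the power of $z$ with bit set
    [A]. *)
Lemma monomial_interpolation (F : finFieldType) (m l : nat)
    (p : {ffun 'I_m -> F}) :
  2%N \in [pchar F] -> #|F| = (2 ^ l)%N ->
  exists W : {ffun 'I_m -> {set 'I_l}} -> F,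
    forall x, \sum_f W f * monomial f x = (x == p)%:R.
Proof.
move=> ch cF.
pose w (c : 'I_l) := (2 ^ (l - c.+1))%N.
pose k (a : F) (A : {set 'I_l}) : F :=
  (A == finset.set0)%:R - \prod_(c in ~: A) (- a) ^+ w c.
have one_dim (a z : F) : \sum_A k a A * \prod_(c in A) z ^+ w c = (z == a)%:R.
  have -> : (z == a)%:R = 1 - (z - a) ^+ #|F|.-1.
    have q_gt1 := finNzRing_gt1 F.
    have [->|za] := eqVneq z a.
      by rewrite subrr expr0n eqn0Ngt -subn1 subn_gt0 q_gt1 subr0.
    have za0 : z - a != 0 by rewrite subr_eq0.
    apply/esym/eqP; rewrite subr_eq0 eq_sym; apply/eqP/(mulfI za0).
    by rewrite mulr1 -exprS prednK ?expf_card // ltnW.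
  rewrite cF -sum_bits expr_sum; under [in RHS]eq_bigr do rewrite frobenius2 //.
  rewrite bigA_distr; under [in LHS]eq_bigr do rewrite /k mulrBl.
  rewrite big_split sumrN /=; congr (_ - _).
    rewrite (bigD1 finset.set0) //= eqxx mul1r big_set0 big1 ?addr0 // => A
      /negPf->.
    by rewrite mul0r.
  apply: eq_bigr => A _; rewrite mulrC big_mkcond [X in _ * X]big_mkcond
    -big_split.
  by apply: eq_bigr => c _; rewrite inE /=; case: ifP; rewrite ?mulr1 ?mul1r.
exists (fun f => \prod_j k (p j) (f j)) => x.
transitivity (\prod_j ((x j == p j)%:R : F)).
  under [RHS]eq_bigr do rewrite -one_dim.
  rewrite bigA_distr_bigA; apply: eq_bigr => f _.
  by rewrite -big_split.
have [->|xp] := eqVneq x p; first by rewrite big1 // => j _; rewrite eqxx.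
have [j xj] : exists j, x j != p j.
  apply/existsP; apply: contraT; rewrite negb_exists => /forallP e.
  by case/eqP: xp; apply/ffunP => j; have := e j; rewrite negbK => /eqP.
by rewrite (bigD1 j) //= (negPf xj) mul0r.
Qed.

(* Only bad monomials contribute, since the others are orthogonal to every
   check. *)
Lemma line_checks_factor (F : finFieldType) (m l s : nat) :
  2%N \in [pchar F] -> #|F| = (2 ^ l)%N -> (0 < l)%N ->
  exists W : {ffun 'I_m -> F} -> {ffun 'I_m -> {set 'I_l}} -> F,
    forall (x v p : {ffun 'I_m -> F}) (i : nat), (i < 2 ^ s)%N ->
      \sum_(t | line_point x v t == p) t ^+ i =
      \sum_(f | bad_exponent s f)
         W p f * \sum_t t ^+ i * monomial f (line_point x v t).
Proof.
move=> ch cF l_gt0.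
have [W WP] := choice (fun p => @monomial_interpolation F m l p ch cF).
exists W => x v p i i_lt; rewrite [RHS]big_mkcond [LHS]big_mkcond /=.
transitivity (\sum_t t ^+ i * \sum_f W p f * monomial f (line_point x v t)).
  by apply: eq_bigr => t _; rewrite WP; case: ifP; rewrite ?mulr1 ?mulr0.
under [LHS]eq_bigr do rewrite mulr_sumr; rewrite [LHS]exchange_big.
apply: eq_bigr => f _ /=; under eq_bigr do rewrite mulrCA; rewrite -mulr_sumr.
by case: ifPn => // good; rewrite (monomial_line_sum _ _ ch cF l_gt0 good i_lt)
  mulr0.
Qed.

(** * The codes *)

Lemma check_matrix (F : finFieldType) (m l s : nat) :
  2%N \in [pchar F] -> #|F| = (2 ^ l)%N -> (0 < l)%N ->
  exists c (H : 'M['F_2]_(#|{ffun 'I_m -> F}|, c)),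
    (\rank H <= (if s == 0 then 1 else l) *
       #|[set f : {ffun 'I_m -> {set 'I_l}} | bad_exponent s f]|)%N /\
    forall z : 'rV['F_2]_ _, z *m H = 0 ->
      forall (x v : {ffun 'I_m -> F}) (i : nat), (i < 2 ^ s)%N ->
        \sum_t t ^+ i * (z 0 (enum_rank (line_point x v t)))%:R = 0.
Proof.
move=> ch cF l_gt0; have [W WP] := line_checks_factor m s ch cF l_gt0.
set B := [set f | _]; pose T := {ffun 'I_m -> F}.
pose L := pPrimeCharType ch.
pose iota : {rmorphism 'F_2 -> L} := in_alg L.
have checkE (z : 'rV['F_2]_#|T|) (x v : T) i :
    \sum_t t ^+ i * (z 0 (enum_rank (line_point x v t)))%:R =
    \sum_a (z 0 a)%:R * \sum_(t | line_point x v t == enum_val a) t ^+ i :> F.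
  under [RHS]eq_bigr do rewrite mulr_sumr big_mkcond; rewrite [RHS]exchange_big.
  apply: eq_bigr => t _; rewrite -big_mkcond (big_pred1 (enum_rank (line_point
    x v t))).
    by rewrite mulrC.
  by move=> a /=; apply/eqP/eqP => ->; rewrite ?enum_valK ?enum_rankK.
(* For [s = 0] only [i = 0] occurs and the check coefficients are counts, hence binary. The rank is
   unchanged over [F], where the matrix factors through the bad monomials. *)
case: (posnP s) => [s0|s_gt0].
- exists #|{: T * T}|.
  pose k2 (k : 'I_#|{: T * T}|) := enum_val k.
  pose H : 'M['F_2]_(#|T|, #|{: T * T}|) := \matrix_(a, k)
    \sum_(t : F | line_point (k2 k).1 (k2 k).2 t == enum_val a) 1.
  have HE a k : iota (H a k) =
      \sum_(t : F | line_point (k2 k).1 (k2 k).2 t == enum_val a) t ^+ 0.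
    by rewrite mxE rmorph_sum; apply: eq_bigr => t _; rewrite rmorph1.
  exists H; split.
    rewrite mul1n -(mxrank_map (iota)).
    have -> : map_mx (iota) H =
        (\matrix_(a < #|T|, b < #|B|) (W (enum_val a) (enum_val b) : L)) *m
        (\matrix_(b < #|B|, k < #|{: T * T}|) (\sum_t t ^+ 0 *
           monomial (enum_val b) (line_point (k2 k).1 (k2 k).2 t) : L)).
      apply/matrixP => a k; rewrite [LHS]mxE HE mxE.
      rewrite (WP (k2 k).1 (k2 k).2) ?expn_gt0 //.
      rewrite (eq_bigl (mem B)) => [|f]; last by rewrite !inE.
      by rewrite [LHS]big_enum_val; apply: eq_bigr => b _; rewrite !mxE.
    exact: mulmx_max_rank.
  move=> z zH x v i; rewrite s0 ltnS leqn0 => /eqP->; rewrite checkE.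
  have zH0 : (z *m H) 0 (enum_rank (x, v)) = 0 by rewrite zH mxE.
  have := congr1 iota zH0; rewrite mxE rmorph0 rmorph_sum => e.
  rewrite -[RHS]e; apply: eq_bigr => a _; rewrite rmorphM HE /k2 enum_rankK /=.
  by congr (_ * _); rewrite -[LHS]mulr1.
(* For [s > 0] a stronger condition is imposed: $\sum_a z_aW_{a,f}=0$ for every bad [f], split by
   the $\mathbb{F}_2$-linear coordinates [phi] into [l] binary checks each. *)
- have [phi phi_lin phi_bij] := pprimeChar_vectAxiom ch.
  pose d := logn 2 #|L|.
  pose J := ('I_#|B| * 'I_d)%type.
  pose H : 'M['F_2]_(#|T|, #|{: J}|) := \matrix_(a, k)
    phi (W (enum_val a) (enum_val (enum_val k).1)) 0 (enum_val k).2.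
  exists #|{: J}|, H; split.
    apply: leq_trans (rank_leq_col _) _; rewrite card_prod !card_ord mulnC.
    by rewrite /d [#|L|]cF pfactorK.
  move=> z zH x v i i_lt; rewrite checkE.
  have phi0 : phi 0 = 0 by have := phi_lin (-1) 0 0;
    rewrite scaler0 addr0 scaleN1r addNr.
  have phiD y y' : phi (y + y') = phi y + phi y'.
    by have := phi_lin 1 y y'; rewrite !scale1r.
  have phiZ a y : phi (a *: y) = a *: phi y.
    by have := phi_lin a y 0; rewrite phi0 !addr0.
  have zW (f : {ffun 'I_m -> {set 'I_l}}) : bad_exponent s f ->
      \sum_a (z 0 a)%:R * W (enum_val a) f = 0.
    move=> bad_f; have fB : f \in B by rewrite inE.
    apply: (bij_inj phi_bij); rewrite phi0 (big_morph phi phiD phi0).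
    apply/rowP => j; rewrite summxE [RHS]mxE.
    have : (z *m H) 0 (enum_rank (enum_rank_in fB f, j)) = 0 by rewrite zH mxE.
    rewrite mxE => e; rewrite -[RHS]e; apply: eq_bigr => a _.
    rewrite [H _ _]mxE enum_rankK /= enum_rankK_in //.
    transitivity (phi (z 0 a *: (W (enum_val a) f : L)) 0 j) => //.
    by rewrite phiZ mxE.
  under eq_bigr => a _ do rewrite WP // mulr_sumr.
  rewrite exchange_big big1 // => f bad_f /=.
  under eq_bigr do rewrite mulrA.
  by rewrite -mulr_suml zW // mul0r.
Qed.

(** * From parity checks to batch codes *)

(** The rows of [H] indexed by [J] form a basis of its row space. Each message position [h i] lies
    outside [J], and its row is cancelled by a combination of basis rows. The codewords are thus
    supported on at most [n + r] positions, to which [psi] restricts. *)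
Lemma systematic_encoding (K : fieldType) N c (H : 'M[K]_(N, c)) n r :
  (\rank H <= r)%N -> (n + r <= N)%N ->
  exists (E : 'M[K]_(n, N)) (h : 'I_n -> 'I_N) (psi : 'I_(n + r) -> 'I_N),
    [/\ E *m H = 0, forall i i', E i (h i') = (i == i')%:R, injective psi &
        forall i p, p \notin codom psi -> E i p = 0].
Proof.
move=> rkH nrN; set f := maxrankfun H.
pose J := [set f j | j : 'I_(\rank H)].
have cJ : #|J| = \rank H.
  by rewrite card_imset ?card_ord //; apply: maxrankfun_inj.
have n_le : (n <= size (enum (~: J)))%N.
  by rewrite -cardE cardsCs finset.setCK card_ord cJ; lia.
have N_gt (i : 'I_n) : 'I_N by apply: (@Ordinal N 0); have := ltn_ord i; lia.
pose h (i : 'I_n) : 'I_N := nth (N_gt i) (enum (~: J)) i.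
have hJ i : h i \notin J.
  by rewrite -finset.in_setC -mem_enum mem_nth // (leq_trans (ltn_ord i)).
have h_inj : injective h.
  move=> i i'; rewrite /h (set_nth_default (N_gt i')).
    move/eqP; rewrite nth_uniq ?enum_uniq ?(leq_trans (ltn_ord _)) // => /eqP.
    exact: ord_inj.
  by rewrite (leq_trans (ltn_ord _)).
have /submxP[P PE] : (rowsub h H <= rowsub f H)%MS.
  rewrite (eq_maxrowsub H); apply/row_subP => i.
  by rewrite row_rowsub row_sub.
pose Hs : 'M[K]_(n, N) := \matrix_(i, p) (h i == p)%:R.
pose Fs : 'M[K]_(\rank H, N) := \matrix_(j, p) (f j == p)%:R.
have selE k (g : 'I_k -> 'I_N) :
    (\matrix_(i, p) (g i == p)%:R : 'M[K]_(k, N)) *m H = rowsub g H.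
  apply/matrixP => i q; rewrite !mxE (bigD1 (g i)) //= mxE eqxx mul1r big1
    ?addr0 //.
  by move=> p pg; rewrite mxE eq_sym (negPf pg) mul0r.
pose S := J :|: [set h i | i : 'I_n].
(* Listing [S] first makes the first [n + r] entries cover it, padded by other positions. *)
pose sq := enum S ++ enum (~: S).
have sq_uniq : uniq sq.
  rewrite cat_uniq !enum_uniq andbT /=; apply/hasPn => p.
  by rewrite !mem_enum inE.
have sz_sq : size sq = N by rewrite size_cat -!cardE cardsC card_ord.
have S_le : (size (enum S) <= n + r)%N.
  rewrite -cardE; apply: leq_trans (leq_card_setU _ _) _.
  by rewrite cJ card_imset // card_ord addnC leq_add2l.
have N_gt' (i : 'I_(n + r)) : 'I_N by apply: (@Ordinal N 0); have := ltn_ord i;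
  lia.
pose psi (i : 'I_(n + r)) : 'I_N := nth (N_gt' i) sq i.
exists (Hs - P *m Fs), h, psi; split.
- by rewrite mulmxBl -mulmxA !selE PE subrr.
- move=> i i'; rewrite !mxE (inj_eq h_inj) big1 ?subr0 // => j _.
  rewrite mxE; have [e|] := eqVneq; last by rewrite mulr0.
  by have := hJ i'; rewrite -e imset_f.
- move=> i i'; rewrite /psi (set_nth_default (N_gt' i')).
    move/eqP; rewrite nth_uniq ?sz_sq ?(leq_trans (ltn_ord _)) // => /eqP.
    exact: ord_inj.
  by rewrite sz_sq (leq_trans (ltn_ord _)).
move=> i p pN.
have pS : p \notin S.
  apply: contra pN => pS; have lt_p : (index p sq < n + r)%N.
    by rewrite /sq index_cat mem_enum pS (leq_trans _ S_le) // index_mem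
      mem_enum.
  apply/codomP; exists (Ordinal lt_p); rewrite /psi nth_index //.
  by rewrite mem_cat mem_enum pS.
have ph : h i != p by apply: contraNneq pS => <-; rewrite inE imset_f ?orbT.
rewrite !mxE (negPf ph) big1 ?subr0 // => j _; rewrite mxE.
have pf : f j != p by apply: contraNneq pS => <-; rewrite inE imset_f.
by rewrite (negPf pf) mulr0.
Qed.

(** Coordinates outside the image of [psi] vanish on all codewords and can be deleted. By linearity,
    vanishing on [A j] forcing a zero at the requested point means that the values on [A j]
    determine the symbol there. *)
Lemma batch_code_of_recovery (K : finFieldType) (n N r k c : nat)
    (H : 'M[K]_(N, c)) :
  (\rank H <= r)%N -> (n + r <= N)%N ->
  (forall pts : 'I_k -> 'I_N, exists A : 'I_k -> {set 'I_N},
     (forall j j', j != j' -> [disjoint A j & A j']) /\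
     forall j (z : 'rV[K]_N), z *m H = 0 -> (forall a, a \in A j -> z 0 a = 0)
       ->
       z 0 (pts j) = 0) ->
  exists enc : 'rV[K]_n -> 'rV[K]_(n + r), batch_code k enc.
Proof.
move=> rkH nrN rec.
have [E [h [psi [EH Eh psi_inj Epsi]]]] := systematic_encoding rkH nrN.
pose enc (x : 'rV[K]_n) : 'rV[K]_(n + r) := \row_i (x *m E) 0 (psi i).
have xEh (x : 'rV[K]_n) i : (x *m E) 0 (h i) = x 0 i.
  rewrite mxE (bigD1 i) //= Eh eqxx mulr1 big1 ?addr0 // => i' ii'.
  by rewrite Eh (negPf ii') mulr0.
have xE0 (x : 'rV[K]_n) p : p \notin codom psi -> (x *m E) 0 p = 0.
  by move=> pN; rewrite mxE big1 // => i _; rewrite Epsi // mulr0.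
have agree (x y : 'rV[K]_n) (A : {set 'I_N}) i :
    (forall z : 'rV[K]_N, z *m H = 0 -> (forall a, a \in A -> z 0 a = 0) ->
       z 0 (h i) = 0) ->
    (forall b, psi b \in A -> enc x 0 b = enc y 0 b) -> x 0 i = y 0 i.
  move=> recA xy; apply/eqP; rewrite -subr_eq0 -!xEh; apply/eqP.
  have subE p : ((x - y) *m E) 0 p = (x *m E) 0 p - (y *m E) 0 p.
    by rewrite mulmxBl mxE [X in _ + X]mxE.
  rewrite -subE; apply: recA => [|a aA]; first by rewrite -mulmxA EH mulmx0.
  rewrite subE; have [/codomP[b ab]|aN] := boolP (a \in codom psi).
    by have := xy b; rewrite !mxE -ab aA => ->; rewrite ?subrr.
  by rewrite !xE0 // subrr.
exists enc; split.
  move=> x y xy; apply/rowP => i; apply: (agree x y [set: 'I_N]).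
    by move=> z _ z0; rewrite z0 ?inE.
  by move=> b _; rewrite xy.
move=> i; have [A [Adisj Arec]] := rec (fun j => h (tnth i j)).
pose A' j := [set b | psi b \in A j].
(* The decoder reads the symbol off any message consistent with [y]; the value $0$ at inconsistent
   [y] is a default. *)
pose g j (y : {ffun {l : 'I_(n + r) | l \in A' j} -> K}) : K :=
  if [pick x : 'rV[K]_n | restrict_to (A' j) (enc x) == y] is Some x
  then x 0 (tnth i j) else 0.
exists A', g; split.
  move=> j j' jj'; rewrite -finset.setI_eq0; apply/eqP/setP => b; rewrite !inE.
  by apply: contraTF (Adisj _ _ jj') => /andP[bj bj']; apply/pred0Pn;
    exists (psi b); apply/andP.
move=> x j; rewrite /g; case: pickP => [x' /eqP e|/(_ x)]; last by rewrite eqxx.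
apply: (agree x' x (A j)) => [z zH z0|b bA]; first exact: Arec z0.
have bA' : b \in A' j by rewrite inE.
by have /ffunP/(_ (exist _ b bA')) := e; rewrite !ffunE.
Qed.

(** * Recovery along lines *)

(** Requests are served in turn: before each one, fewer than [B] points have been used, and the new
    set avoids them all. *)
Lemma greedy_recovery (T : finType) (rec : T -> {set T} -> Prop) (d B k : nat)
    (pts : nat -> T) :
  (0 < d)%N -> (k * d <= B)%N ->
  (forall p (U : {set T}), (#|U| < B)%N ->
     exists A, [/\ rec p A, [disjoint A & U] & (#|A| <= d)%N]) ->
  exists A : nat -> {set T},
    [/\ forall i, (i < k)%N -> rec (pts i) (A i),
        forall i i', (i < i' < k)%N -> [disjoint A i & A i'] &
        (#|\bigcup_(i < k) A i| <= k * d)%N].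
Proof.
move=> d_gt0 kB step; elim: k kB => [|k IH] kB.
  by exists (fun=> finset.set0); split=> //; [move=> i i';
    lia | rewrite big_ord0 cards0].
have [|A [Arec Adisj Acard]] := IH; first by apply: leq_trans kB;
  rewrite leq_mul2r leqnSn orbT.
have [|A' [A'rec A'disj A'card]] := step (pts k) (\bigcup_(i < k) A i).
  apply: leq_ltn_trans Acard (leq_trans _ kB).
  by rewrite mulSn -[ltnLHS]add0n ltn_add2r.
exists (fun i => if i == k then A' else A i); split.
- move=> i; rewrite ltnS leq_eqVlt; case: eqP => [->|_ /=] //; exact: Arec.
- move=> i i' /andP[ii' i'k1].
  have -> : (i == k) = false by apply: ltn_eqF; apply: leq_trans ii' _.
  move: i'k1; rewrite ltnS leq_eqVlt.
  case: eqP => [i'k _|_ /= i'k]; last by apply: Adisj; rewrite ii'.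
  rewrite disjoint_sym; apply: fintype.disjointWr A'disj.
  rewrite i'k in ii'; exact: (finset.bigcup_sup (Ordinal ii')  (F := fun j :
    'I_k => A j)).
rewrite big_ord_recr /= eqxx; apply: leq_trans (leq_card_setU _ _) _.
rewrite mulSn addnC leq_add //.
by rewrite (eq_bigr (fun i : 'I_k => A i)) // => i _; rewrite ltn_eqF.
Qed.

(** The $q^m$ lines through [p] considered here are disjoint away from [p]. If each met [U] in at
    least [r] other points, [U] would be too large. *)
Lemma sparse_line (F : finFieldType) (m r : nat) (p : {ffun 'I_m.+1 -> F})
    (U : {set {ffun 'I_m.+1 -> F}}) :
  (#|U| < r * #|F| ^ m)%N ->
  exists v : {ffun 'I_m.+1 -> F},
    (#|[set t : F | (t != 0%R) && (line_point p v t \in U)]| < r)%N.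
Proof.
move=> U_lt.
(* Fixing the first coordinate of the direction to $1$ makes the parameter [t], and then [w],
   readable from a point other than [p]. *)
pose dir (w : {ffun 'I_m -> F}) : {ffun 'I_m.+1 -> F} :=
  [ffun j => if unlift ord0 j is Some j' then w j' else 1].
pose bad w := [set t | (t != 0) && (line_point p (dir w) t \in U)].
suff [w w_lt] : exists w, (#|bad w| < r)%N.
  by exists (dir w).
apply/existsP; apply: contraLR U_lt; rewrite negb_exists => /forallP bad_ge.
have -> : (r * #|F| ^ m = \sum_(w : {ffun 'I_m -> F}) r)%N.
  by rewrite sum_nat_const card_ffun card_ord mulnC.
rewrite -leqNgt; apply: (@leq_trans (\sum_w #|bad w|)%N).
  by apply: leq_sum => w _; rewrite leqNgt.
under eq_bigr => w _ do rewrite -sum1_card.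
rewrite pair_big_dep /= sum1dep_card.
pose pt (u : {ffun 'I_m -> F} * F) := line_point p (dir u.1) u.2.
rewrite -(@card_in_imset _ _ pt) ?subset_leq_card //.
  by apply/fintype.subsetP => _ /imsetP[u + ->]; rewrite !inE => /andP[].
move=> [w t] [w' t']; rewrite !inE /= => /andP[t0 _] /andP[t0' _] /ffunP e.
have tt' : t = t'.
  by have := e ord0; rewrite !ffunE unlift_none !mulr1 => /addrI.
congr (_, _) => //; apply/ffunP => j; have := e (lift ord0 j).
by rewrite !ffunE liftK tt' => /addrI/(mulfI t0').
Qed.

(* The polynomial vanishing at the unreadable positions combines the r checks
   of the line into a relation between its centre and the readable points. *)
Lemma line_recovery (F : finFieldType) (m r : nat) (p v : {ffun 'I_m -> F})
    (U : {set {ffun 'I_m -> F}}) (y : {ffun 'I_m -> F} -> F) :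
  (#|[set t : F | (t != 0%R) && (line_point p v t \in U)]| < r)%N ->
  (forall i, (i < r)%N -> \sum_t t ^+ i * y (line_point p v t) = 0) ->
  (forall t, t != 0 -> line_point p v t \notin U -> y (line_point p v t) = 0) ->
  y p = 0.
Proof.
set V := [set t | _] => V_lt checks y0.
have p0 : line_point p v 0 = p by apply/ffunP => j; rewrite ffunE mul0r addr0.
pose P := \prod_(u in V) ('X - u%:P).
have sP : size P = #|V|.+1 by rewrite /P -big_enum size_prod_XsubC -cardE.
have P0 : P.[0] != 0.
  rewrite horner_prod; apply/prodf_neq0 => u; rewrite inE => /andP[u0 _].
  by rewrite hornerXsubC sub0r oppr_eq0.
have : \sum_t P.[t] * y (line_point p v t) = 0.
  under eq_bigr do rewrite horner_coef mulr_suml.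
  rewrite exchange_big big1 // => i _ /=.
  under eq_bigr do rewrite -mulrA.
  by rewrite -mulr_sumr checks ?mulr0 // (leq_trans (ltn_ord i)) // sP.
rewrite (bigD1 0) //= big1 ?addr0 ?p0 => [/eqP|t t0].
  by rewrite mulf_eq0 (negPf P0) => /eqP.
have [tV|tV] := boolP (t \in V).
  by rewrite horner_prod (bigD1 t) //= hornerXsubC subrr !mul0r.
by rewrite y0 ?mulr0 //; move: tV; rewrite inE t0.
Qed.

Lemma natr_F2_eq0 (F : finFieldType) (a : 'F_2) : (a%:R == 0 :> F) = (a == 0).
Proof.
by case: a => [[|[|a]] ?] //=; rewrite ?eqxx // oner_eq0.
Qed.

(** Each request costs at most $q-1$ points, and a sparse line exists while fewer than $2^sq^{m+1}$
    points are used, so $2^sq^m$ requests can be served in dimension [m.+2]. *)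
Lemma line_batch_code (m l s n k r : nat) :
  (s < l)%N -> (k <= 2 ^ (s + l * m))%N -> (n + r <= 2 ^ (l * m.+2))%N ->
  ((if s == 0 then 1 else l) *
     (2 ^ (m.+2 * s) * \sum_(j < m.+2) surviving m.+2 (l - s) j) <= r)%N ->
  exists enc : 'rV['F_2]_n -> 'rV['F_2]_(n + r), batch_code k enc.
Proof.
move=> sl k_le nr_le r_ge; have l_gt0 : (0 < l)%N by lia.
have [F ch cF] := pPrimePowerField (isT : prime 2) l_gt0.
have q_gt1 := finNzRing_gt1 F.
pose T : finType := {ffun 'I_m.+2 -> F}.
have cT : #|T| = (2 ^ (l * m.+2))%N by rewrite card_ffun card_ord cF expnM.
have [c [H [rkH HP]]] := check_matrix m.+2 s ch cF l_gt0.
apply: (@batch_code_of_recovery _ n #|T| r k c H) => //.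
- apply: leq_trans r_ge; apply: leq_trans rkH _; rewrite leq_mul2l; apply/orP;
  right.
  have := @card_bad_exponent m.+2 (l - s) s; rewrite (subnK (ltnW sl)) subn_gt0.
  exact.
- by rewrite cT.
move=> pts; have p0 : T := [ffun=> 0].
pose rec (p : T) (A : {set T}) := forall z : 'rV['F_2]_#|T|, z *m H = 0 ->
  (forall a, a \in A -> z 0 (enum_rank a) = 0) -> z 0 (enum_rank p) = 0.
have [||p U U_lt|A [Arec Adisj _]] := @greedy_recovery T rec #|F|.-1
    (2 ^ s * #|F| ^ m.+1) k
    (fun i => if insub i is Some i' then enum_val (pts i') else p0).
- by rewrite -subn1 subn_gt0.
- apply: (@leq_trans (2 ^ (s + l * m) * #|F|)).
    by rewrite leq_mul // leq_pred.
  by rewrite expnD expnM -cF -mulnA -expnSr.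
- have [v V_lt] := sparse_line p U_lt.
  exists [set line_point p v t | t in [set t | (t != 0) && (line_point p v t
    \notin U)]].
  split.
  + move=> z zH z0; apply/eqP; rewrite -(natr_F2_eq0 F); apply/eqP.
    apply: (line_recovery (y := fun x => (z 0 (enum_rank x))%:R) V_lt) => [i
      i_lt|t t0 tU].
      exact: HP.
    by rewrite z0 //; apply/imsetP; exists t; rewrite ?inE ?t0.
  + rewrite -finset.setI_eq0; apply/eqP/setP => x; rewrite !inE.
    apply/negbTE/andP => -[/imsetP[t + ->]]; rewrite inE => /andP[_].
    by move/negPf => ->.
  + apply: leq_trans (leq_imset_card _ _) _; rewrite -(cardC1 (0 : F)).
    by apply/subset_leq_card/fintype.subsetP => t; rewrite !inE => /andP[].
exists (fun j => [set enum_rank x | x in A j]); split.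
  move=> j j' jj'.
  have disj (i i' : 'I_k) : (i < i')%N ->
      [disjoint [set enum_rank x | x in A i] & [set enum_rank x | x in A i']].
    move=> ii'; rewrite -finset.setI_eq0 -imsetI;
      last by move=> x y _ _ /enum_rank_inj.
    have := Adisj i i'; rewrite ii' ltn_ord => /(_ isT).
    by rewrite -finset.setI_eq0 => /eqP->; rewrite imset0.
  by move: jj'; rewrite neq_ltn => /orP[/disj //|/disj]; rewrite disjoint_sym.
move=> j z zH z0; have := Arec j (ltn_ord j); rewrite valK => /(_ z zH).
by rewrite enum_valK; apply=> a aA; rewrite z0 // imset_f.
Qed.

(** * Asymptotics *)

(** With at most one request disjointness is vacuous, and an empty set of checks suffices. *)
Lemma identity_batch_code (K : finFieldType) (n k : nat) : (k <= 1)%N ->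
  exists enc : 'rV[K]_n -> 'rV[K]_(n + 0), batch_code k enc.
Proof.
move=> k1; apply: (@batch_code_of_recovery K n n 0 k 0 0);
  rewrite ?mxrank0 ?addn0 //.
move=> pts; exists (fun j => [set pts j]); split => [j j'|j z _ z0].
  by rewrite -val_eqE /=; have := ltn_ord j; have := ltn_ord j'; lia.
by rewrite z0 // inE.
Qed.

Lemma powR2_log2 (R : realType) (x : R) : 0 < x -> 2 `^ log2 x = x.
Proof.
move=> x0; have ln2 : 0 < ln (2 : R) by rewrite ln_gt0 // ltr1n.
by rewrite /powR pnatr_eq0 /= /log2 divfK ?gt_eqF // lnK.
Qed.

Lemma powR2D (R : realType) (x y : R) : 2 `^ (x + y) = 2 `^ x * 2 `^ y.
Proof. by rewrite powRD // pnatr_eq0 implybT. Qed.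

Lemma ler_powR2 (R : realType) (x y : R) : (2 `^ x <= 2 `^ y) = (x <= y).
Proof.
rewrite /powR pnatr_eq0 /= ler_expR ler_pM2r //.
by rewrite ln_gt0 // ltr1n.
Qed.

(** Squaring $e^y\ge 1+y$ with $y=cl\ln 2/2$ gives a quadratic lower bound. *)
Lemma linear_le_powR2 (R : realType) (K c : R) : 0 < c ->
  exists l0 : nat, forall l : nat, (l0 <= l)%N -> K * l%:R <= 2 `^ (c * l%:R).
Proof.
move=> c0; pose d := c * ln (2 : R) / 2.
have d0 : 0 < d by rewrite divr_gt0 ?mulr_gt0 // ln_gt0 // ltr1n.
exists (Num.truncn (K / d ^+ 2)).+1 => l l_ge.
have Kl : K <= d ^+ 2 * l%:R.
  rewrite -ler_pdivrMl ?exprn_gt0 // mulrC; apply: ltW.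
  by apply: lt_le_trans (truncnS_gt _) _; rewrite ler_nat.
apply: (@le_trans _ _ ((d * l%:R) ^+ 2)).
  by rewrite expr2 mulrACA -expr2 mulrA ler_wpM2r.
have -> : 2 `^ (c * l%:R) = expR (d * l%:R) ^+ 2 :> R.
  rewrite -expRM_natl /powR pnatr_eq0 /=; congr expR.
  by rewrite /d; field.
have dl : 0 <= d * l%:R by rewrite mulr_ge0 // ltW.
apply: lerXn2r; rewrite ?nnegrE ?expR_ge0 //.
by apply: le_trans (expR_ge1Dx _); rewrite lerDr.
Qed.

Lemma log2_batch_lambda (R : realType) (m : nat) : (1 < m)%N ->
  0 <= log2 (batch_lambda R m) < m%:R.
Proof.
move=> m_gt1; have lam2 := batch_lambda_ge2 R m_gt1.
have lam_gt0 : 0 < batch_lambda R m by apply: lt_le_trans lam2.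
apply/andP; split.
  by rewrite -ler_powR2 powR2_log2 // powRr0 (le_trans _ lam2) // ler1n.
by rewrite ltNge -ler_powR2 powR2_log2 // powR_mulrn // -ltNge batch_lambda_lt.
Qed.

Definition redundancy (m l s : nat) : nat :=
  ((if s == 0 then 1 else l) *
     (2 ^ (m * s) * \sum_(j < m) surviving m (l - s) j))%N.

(* The parameter s is about rho * l; it is taken slightly smaller
   to absorb the factor l of the redundancy, at the expense of delta. *)
Lemma line_parameters (R : realType) (m : nat) (rho delta lam : R) :
  (1 < m)%N -> 0 <= rho <= 1 -> 0 < delta -> lam = log2 (batch_lambda R m) ->
  exists (s : nat -> nat) (C : R) (l0 : nat), 0 <= C /\
    forall l, (l0 <= l)%N ->
      [/\ (s l < l)%N, l%:R * (rho - delta) <= (s l)%:R,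
          (redundancy m l (s l))%:R <= C * 2 `^ (l%:R * (lam + rho * (m%:R -
            lam))) &
          2 ^+ (2 * m) * (redundancy m l (s l))%:R <= 2 ^+ (l * m) :> R].
Proof.
move=> m_gt1 /andP[rho0 rho1] delta0 lamE.
have L_gt0 : 0 < batch_lambda R m by apply: lt_le_trans (batch_lambda_ge2 R
  m_gt1).
have lam2 : 2 `^ lam = batch_lambda R m by rewrite lamE powR2_log2.
have /andP[_ lam_lt] : 0 <= lam < m%:R by rewrite lamE log2_batch_lambda.
have [C C0 surv_le] := surviving_le R m_gt1.
have lamX l : batch_lambda R m ^+ l = 2 `^ (l%:R * lam).
  by rewrite mulrC powRrM lam2 powR_mulrn // ltW.
have powX (k l : nat) : 2 ^+ (k * l) = 2 `^ (k%:R * l%:R) :> R.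
  by rewrite -natrM powR_mulrn.
have surv_le' l s : (s <= l)%N ->
    (2 ^ (m * s) * \sum_(j < m) surviving m (l - s) j)%:R <=
      C * 2 `^ (l%:R * lam + s%:R * (m%:R - lam)).
  move=> sl; rewrite natrM natrX powX natr_sum.
  apply: (@le_trans _ _ (2 `^ (m%:R * s%:R) * (C * batch_lambda R m ^+ (l -
    s)))).
    by rewrite ler_wpM2l ?powR_ge0.
  rewrite lamX mulrCA -powR2D natrB // ler_pM2l // ler_powR2.
  by rewrite le_eqVlt; apply/orP; left; apply/eqP; ring.
(* For small [rho] there is no room to lower it, but then [s = 0] is allowed and the factor [l] is
   absent. *)
have [rho_small|rho_big] := leP rho (delta / 2).
- have gap : 0 < m%:R - lam by rewrite subr_gt0.
  have [l0 l0P] := linear_le_powR2 (2 ^+ (2 * m) * C) gap.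
  exists (fun=> 0%N), C, l0.+1; split=> [|l l_ge]; first exact: ltW.
  have l_gt0 : (0 < l)%N := leq_ltn_trans (leq0n _) l_ge.
  have := surv_le' l 0%N (leq0n l); rewrite mul0r addr0 => red_le.
  rewrite /redundancy eqxx mul1n; split=> //.
  + by rewrite mulr_ge0_le0 // subr_le0; lra.
  + apply: le_trans red_le _; rewrite ler_pM2l // ler_powR2 ler_wpM2l //.
    by rewrite lerDl mulr_ge0 // subr_ge0 ltW.
  apply: (@le_trans _ _ (2 ^+ (2 * m) * (C * 2 `^ (l%:R * lam)))).
    by rewrite ler_pM2l ?exprn_gt0.
  rewrite (powX l m) mulrA -[l%:R * m%:R](subrK (l%:R * lam)) -mulrBr powR2D.
  rewrite ler_wpM2r ?powR_ge0 // [_ * (_ - _)]mulrC.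
  apply: le_trans (l0P l (ltnW l_ge)).
  by rewrite ler_peMr ?ler1n // mulr_ge0 ?exprn_ge0 // ltW.
(* Half of [delta] is spent here, gaining an exponential factor that absorbs [l] and the constants;
   the other half covers the rounding of [s]. *)
pose rho' := rho - delta / 2.
have rho'_gt0 : 0 < rho' by rewrite subr_gt0.
have rho'_lt1 : rho' < 1 by rewrite /rho'; lra.
have gap : 0 < (rho - rho') * (m%:R - lam).
  by rewrite mulr_gt0 ?subr_gt0 // /rho'; lra.
have [l0 l0P] := linear_le_powR2 (2 ^+ (2 * m) * C) gap.
have [l1 l1P] : exists l1 : nat, forall l, (l1 <= l)%N -> 1 <= l%:R * (delta /
  2).
  exists (Num.truncn (2 / delta)).+1 => l l_ge.
  rewrite mulrA ler_pdivlMr // mul1r -ler_pdivrMr //; apply: ltW.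
  by apply: lt_le_trans (truncnS_gt _) _; rewrite ler_nat.
exists (fun l => Num.truncn (rho' * l%:R)), 1, (maxn l0 l1).+1;
  split=> // l l_ge.
have l_gt0 : (0 < l)%N := leq_ltn_trans (leq0n _) l_ge.
have rl0 : 0 <= rho' * l%:R by rewrite mulr_ge0 // ltW.
set s := Num.truncn _; have s_le : s%:R <= rho' * l%:R by rewrite truncn_le.
have s_gt : rho' * l%:R < s%:R + 1 by rewrite natr1 truncnS_gt.
have sl : (s < l)%N.
  by rewrite -(ltr_nat R) (le_lt_trans s_le) // gtr_pMl ?ltr0n.
pose a := lam + rho' * (m%:R - lam).
have red_le : (redundancy m l s)%:R <= l%:R * (C * 2 `^ (l%:R * a)).
  rewrite natrM ler_pM //; first by case: ifP; rewrite ler_nat.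
  apply: le_trans (surv_le' l s (ltnW sl)) _; rewrite ler_pM2l // ler_powR2.
  rewrite /a [leRHS]mulrDr lerD2l mulrA ler_wpM2r ?subr_ge0 ?(ltW lam_lt) //.
  by rewrite mulrC.
pose b := lam + rho * (m%:R - lam).
have b_le : b <= m%:R.
  rewrite /b -lerBrDl ler_piMl // subr_ge0 ltW //.
have red_le2 : 2 ^+ (2 * m) * (redundancy m l s)%:R <= 2 `^ (l%:R * b).
  apply: (@le_trans _ _ (2 ^+ (2 * m) * (l%:R * (C * 2 `^ (l%:R * a))))).
    by rewrite ler_pM2l ?exprn_gt0.
  have -> : l%:R * b = (rho - rho') * (m%:R - lam) * l%:R + l%:R * a.
    by rewrite /a /b; ring.
  rewrite powR2D (mulrCA l%:R) mulrA mulrA ler_wpM2r ?powR_ge0 //.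
  rewrite mulrA; exact: l0P (leq_trans (leq_maxl _ _) (ltnW l_ge)).
split=> //.
- have := l1P l _; rewrite (leq_trans _ l_ge) ?leqW ?leq_maxr // => /(_ isT).
  by move: s_gt; rewrite /rho'; move: (s%:R : R) (l%:R : R) => S' l' ? ?; nra.
- rewrite mul1r -/b; apply: le_trans red_le2.
  by rewrite ler_peMl // exprn_ege1 // ler1n.
apply: le_trans red_le2 _.
by rewrite powX ler_powR2 ler_wpM2l.
Qed.

(** The summand $2$ in [l] outweighs the rounding: it leaves room for [n] message symbols and [n]
    redundant ones, at the cost of a constant factor. *)
Lemma level_bounds (m n : nat) : (0 < m)%N -> (0 < n)%N ->
  let l := (trunc_log 2 n %/ m + 2)%N in
  (2 * n <= 2 ^ (l * m) <= 2 ^ (2 * m) * n)%N.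
Proof.
move=> m_gt0 n_gt0 /=; have /andP[lo hi] := trunc_log_bounds (isT : (1 < 2)%N)
  n_gt0.
set t := trunc_log 2 n in lo hi *.
have t_eq := divn_eq t m; have t_lt := ltn_pmod t m_gt0.
apply/andP; split.
  rewrite (leq_trans (leq_mul (leqnn 2) (ltnW hi))) // -expnS leq_exp2l //.
  by rewrite mulnDl; lia.
apply: leq_trans (leq_mul (leqnn _) lo).
by rewrite -expnD leq_exp2l // mulnDl; lia.
Qed.

Local Open Scope classical_set_scope.
Local Open Scope ring_scope.

Theorem theorem4 (R : realType) (m : nat) (eps delta : R)
    (m_gt0 : (0 < m)%N)
    (eps_ge : (m%:R - 2) / m%:R <= eps)
    (eps_le : eps <= (m%:R - 1) / m%:R)
    (delta_gt0 : 0 < delta) :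
  exists N : nat -> nat,
    (\forall n \near \oo,
       exists enc : 'rV['F_2]_n -> 'rV['F_2]_(N n),
         real_batch_code (n%:R `^ (eps - delta)) enc) /\
    (fun n : nat => (N n)%:R - n%:R : R) =O_\oo
      (fun n : nat =>
         n%:R `^ ((m%:R - log2 (batch_lambda R m)) * eps
                  + ((m%:R - 1) * log2 (batch_lambda R m) / m%:R - m%:R + 2))
         : R).
Proof.
have ceil_le (x : R) (k : nat) : 0 <= x -> x <= k%:R -> (`|Num.ceil x| <= k)%N.
  move=> x0 xk; rewrite -lez_nat gez0_abs ?ceil_ge0 ?(lt_le_trans _ x0) //.
  by rewrite ceil_le_int.
(* If [eps <= delta], at most one request is made and the identity code has redundancy $0$. *)
have [eps_small|eps_big] := leP eps delta.
  exists (fun n => n + 0)%N; split; last first.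
    apply/eqOP; near=> k; near=> n.
    by rewrite addn0 subrr normr0 mulr_ge0.
  near=> n; have n_gt0 : (0 < n)%N by near: n; exists 1%N.
  apply: identity_batch_code; apply: ceil_le; first exact: powR_ge0.
  rewrite -[leRHS](powRr0 n%:R) ler_powR ?ler1n // subr_le0 //.
have m_gt1 : (1 < m)%N.
  rewrite ltn_neqAle m_gt0 andbT; apply/eqP => m1; move: eps_le.
  by rewrite -m1 subrr mul0r leNgt (lt_trans delta_gt0).
have mR0 : 0 < m%:R :> R by rewrite ltr0n.
set lam := log2 (batch_lambda R m).
(* With $2^{lm}\approx n$, the batch size $2^{s+l(m-2)}$ for $s\ge l(\rho-m\delta)$ is at least
   $2^{lm(\varepsilon-\delta)}$; the bounds on [eps] say exactly that $0\le\rho\le1$. *)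
pose rho := m%:R * eps - m%:R + 2.
have rho01 : 0 <= rho <= 1.
  move: eps_ge eps_le; rewrite ler_pdivrMr // ler_pdivlMr // => ge le.
  by rewrite /rho; apply/andP; split; lra.
have delta'_gt0 : 0 < m%:R * delta by rewrite mulr_gt0.
have [s [C [l0 [C0 sP]]]] := line_parameters m_gt1 rho01 delta'_gt0 (erefl lam).
set e : R := (m%:R - lam) * eps + ((m%:R - 1) * lam / m%:R - m%:R + 2).
have eE : lam + rho * (m%:R - lam) = m%:R * e.
  by rewrite /e /rho; field; rewrite gt_eqF.
pose lev n := (trunc_log 2 n %/ m + 2)%N.
have lev_ge n : (2 ^ (m * l0) <= n)%N -> (l0 <= lev n)%N.
  move=> n_ge; apply: leq_trans (leq_addr _ _); rewrite leq_divRL // mulnC.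
  by rewrite trunc_log_max.
have e_ge0 : 0 <= e.
  have /andP[lam_ge lam_lt] := log2_batch_lambda R m_gt1.
  have /andP[rho_ge _] := rho01.
  by rewrite -(pmulr_rge0 _ mR0) -eE addr_ge0 // mulr_ge0 // subr_ge0 ltW.
exists (fun n => n + redundancy m (lev n) (s (lev n)))%N; split.
  near=> n.
  have n_gt0 : (0 < n)%N by near: n; exists 1%N.
  have l_ge : (l0 <= lev n)%N.
    by apply: lev_ge; near: n; exists (2 ^ (m * l0))%N.
  have [sl s_ge _ red_le] := sP _ l_ge.
  have /andP[n_le le_n] := level_bounds m_gt0 n_gt0.
  have mE : m = (m - 2).+2 by rewrite -addn2 subnK.
  set l := lev n in sl s_ge red_le n_le le_n *.
  (* Both sides are multiplied by $2^{2m}$, so that $2^{lm}$ lies between them. *)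
  have red_n : (redundancy m l (s l) <= n)%N.
    rewrite -(@leq_pmul2l (2 ^ (2 * m))) ?expn_gt0 //.
    apply: leq_trans le_n; rewrite -(ler_nat R) natrM !natrX; exact: red_le.
  suff : (`|Num.ceil (n%:R `^ (eps - delta) : R)| <= 2 ^ (s l + l * (m - 2)))%N.
    move=> k_le; apply: (@line_batch_code (m - 2) l (s l)) => //.
      by rewrite -mE (leq_trans _ n_le) // mul2n -addnn leq_add2l.
    by rewrite -mE.
  apply: ceil_le; first exact: powR_ge0.
  rewrite natrX -powR_mulrn //.
  apply: (@le_trans _ _ ((2 `^ (l%:R * m%:R)) `^ (eps - delta))).
    apply: ge0_ler_powR; rewrite ?nnegrE ?powR_ge0 // ?subr_ge0 ?(ltW eps_big)
      //.
    rewrite -natrM powR_mulrn // -natrX ler_nat.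
    by apply: leq_trans n_le; rewrite leq_pmull.
  rewrite -powRrM ler_powR2 natrD natrM natrB //.
  by move: s_ge; rewrite /rho; lra.
apply/eqOP; near=> k; near=> n.
have n_gt0 : (0 < n)%N by near: n; exists 1%N.
have l_ge : (l0 <= lev n)%N.
  by apply: lev_ge; near: n; exists (2 ^ (m * l0))%N.
have [_ _ red_le _] := sP _ l_ge.
have /andP[_ le_n] := level_bounds m_gt0 n_gt0.
rewrite natrD addrAC subrr add0r !ger0_norm ?powR_ge0 //.
apply: le_trans red_le _.
(* The constant comes from raising $2^{lm}\le 2^{2m}n$ to the power [e], which is non-negative. *)
have k_ge : C * (2 ^+ (2 * m)) `^ e <= k by near: k; apply: nbhs_pinfty_ge;
  rewrite num_real.
apply: (@le_trans _ _ (C * (2 ^+ (2 * m)) `^ e * n%:R `^ e)); last first.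
  by rewrite ler_wpM2r ?powR_ge0.
rewrite -mulrA ler_wpM2l // -powRM ?exprn_ge0 // eE mulrA powRrM.
apply: ge0_ler_powR; rewrite ?nnegrE ?powR_ge0 ?mulr_ge0 ?exprn_ge0 //.
by rewrite -natrM powR_mulrn // -!natrX -natrM ler_nat.
Unshelve. all: by end_near.
Qed.
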